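(* Let $T=\mathbb{R}^n$, let $G\subset \mathrm{O}(n)$ be a compact Lie group, let $A$ be a graded subalgebra of $(\Lambda^*T)^G$ and let $f$ be a differential operator on $A$. Then the space $Z_{A,f}\subset\mathfrak{gl}(n,\mathbb{R})\otimes T$ is non-empty if and only if $f$ extends to a degree $1$ derivation $\tilde f$ of the graded algebra $\Lambda^*T$. In that case, $Z_{A,f}$ is a translate of $Z_{A,0}$, and $\tilde f$ can be taken to be $G$-equivariant.
   Context: $T=\mathbb{R}^n$ carries its standard metric and is identified with its dual $T^*$; $e^1,\dots,e^n$ is the standard basis. $(\Lambda^*T)^G$ is the algebra of $G$-invariant elements of the exterior algebra. A differential operator on a graded subalgebra $A\subset(\Lambda^*T)^G$ is a linear map $f\colon A\to A$ mapping $A\cap\Lambda^pT$ to $A\cap\Lambda^{p+1}T$ for all $p$, satisfying the graded Leibniz rule and $f^2=0$ (i.e. $(A,f)$ is a differential graded algebra). Derivations of degree $1$ satisfy the graded Leibniz rule but are not required to square to zero. Let $M$ be an $n$-manifold with frame bundle $\pi\colon F\to M$ (a $\mathrm{GL}(n,\mathbb{R})$-bundle) and tautological form $\theta=(\theta_1,\dots,\theta_n)$. Let $\iota\colon\Lambda^*T\to\Omega(F)$ be the algebra homomorphism with $\iota(e^i)=\theta_i$. The ideal $\mathcal{I}_{A,f}(F)\subset\Omega(F)$ is the ideal generated by $\{d\iota(\alpha)-\iota(f(\alpha)),\ d\iota(f(\alpha))\mid\alpha\in A\}$. Fix a torsion-free connection form $\omega=(\omega_{ij})$ on $F$, so $d\theta_i=-\sum_j\omega_{ij}\wedge\theta_j$.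 An $n$-plane $E\subset T_uF$ is $\pi$-transverse if it does not meet $\ker\pi_*$ outside zero; such an $E$ corresponds to a unique element $(p_{ijk})\in\mathfrak{gl}(n,\mathbb{R})\otimes T$ via $\omega_{ij}|_E=\sum_k p_{ijk}\theta_k|_E$. The space $Z_{A,f}\subset\mathfrak{gl}(n,\mathbb{R})\otimes T$ is the set of those $(p_{ijk})$ such that all forms in $\mathcal{I}_{A,f}(F)$ restrict to zero on the corresponding plane $E$; it does not depend on $M$, $u$ or the connection. $Z_{A,0}$ is the case of the zero operator. *)

(* Defs.v *)
(* MathComp / MathComp-Analysis *)
From HB Require Import structures.
From mathcomp Require Import all_boot all_order all_algebra.
From mathcomp Require Import ring.
Set Implicit Arguments.
Unset Strict Implicit.
Unset Printing Implicit Defensive.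
Import Order.TTheory GRing.Theory Num.Theory.
Local Open Scope ring_scope.

(* The exterior algebra on generators e_0, ..., e_(n-1): a is the element
   \sum_I a I e_I, where e_I is the product of the e_i, i \in I, in increasing
   order (see ext_basis_prod). *)
Definition ext (R : nzRingType) (n : nat) : Type := {ffun {set 'I_n} -> R^o}.

HB.instance Definition _ (R : nzRingType) (n : nat) :=
  Vector.copy (ext R n) {ffun {set 'I_n} -> R^o}.

(* Number of transpositions needed to sort e_I e_J. *)
Definition ext_inv n (I J : {set 'I_n}) : nat :=
  (\sum_(i in I) \sum_(j in J) (j < i)%N)%N.

Section ExtRing.
Variables (R : comNzRingType) (n : nat).
Implicit Types (a b c : ext R n) (I J K L : {set 'I_n}).

Definition ext_basis I : ext R n := [ffun J => (J == I)%:R].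

Definition ext_mul a b : ext R n :=
  [ffun K : {set 'I_n} => \sum_(I : {set 'I_n} | I \subset K)
     (-1) ^+ ext_inv I (K :\: I) * (a I * b (K :\: I))].

Lemma ext_inv0l I : ext_inv set0 I = 0%N.
Proof. by rewrite /ext_inv big_set0. Qed.

Lemma ext_inv0r I : ext_inv I set0 = 0%N.
Proof. by rewrite /ext_inv big1 // => i _; rewrite big_set0. Qed.

Lemma ext_invUl I J K : [disjoint I & J] ->
  ext_inv (I :|: J) K = (ext_inv I K + ext_inv J K)%N.
Proof.
move=> dIJ; rewrite /ext_inv (eq_bigl [predU I & J]) ?bigU //.
by move=> i; rewrite !inE.
Qed.

Lemma ext_invUr I J K : [disjoint J & K] ->
  ext_inv I (J :|: K) = (ext_inv I J + ext_inv I K)%N.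
Proof.
move=> dJK; rewrite /ext_inv -big_split /=; apply: eq_bigr => i _.
rewrite (eq_bigl [predU J & K]) ?bigU //.
by move=> j; rewrite !inE.
Qed.

Lemma ext_mulA : associative ext_mul.
Proof.
move=> a b c; apply/ffunP => K; rewrite !ffunE.
under eq_bigr => I _.
  rewrite ffunE mulr_sumr mulr_sumr.
  over.
under [RHS]eq_bigr => L _.
  rewrite ffunE mulr_suml mulr_sumr.
  over.
rewrite [RHS](exchange_big_dep (fun I : {set 'I_n} => I \subset K)) /=; last first.
  by move=> L I LK IL; apply: subset_trans IL LK.
apply: eq_bigr => I IK.
rewrite [RHS](reindex_onto (fun J : {set 'I_n} => I :|: J) (fun L => L :\: I)) /=; last first.
  by move=> L /andP[_ IL]; rewrite setDE setUIr setUCr setIT; apply/setUidPr.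
apply: eq_big => [J|J].
  rewrite subUset IK subsetUl !andbT /= subsetD setDUl setDv set0U.
  by congr (_ && _); rewrite setDE (sameP eqP setIidPl) disjoints_subset.
rewrite subsetD => /andP[JK dJI].
have -> : (I :|: J) :\: I = J.
  by rewrite setDUl setDv set0U; apply/setDidPl.
have -> : K :\: (I :|: J) = K :\: I :\: J by rewrite setDDl.
set M := K :\: I :\: J.
have KE : K :\: I = J :|: M.
  rewrite -[LHS](setID _ J) -/M; congr (_ :|: _).
  by apply/setIidPr; rewrite subsetD JK.
have dJM : [disjoint J & M].
  by rewrite disjoint_sym disjoints_subset /M setDE subsetIr.
rewrite ext_invUl 1?disjoint_sym // KE ext_invUr // !exprD.
have aux (x y z p q r : R) :
  x * y * (p * (z * (q * r))) = y * z * (x * (p * q) * r) by ring.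
exact: aux.
Qed.

Lemma ext_mul1 : left_id (ext_basis set0) ext_mul.
Proof.
move=> a; apply/ffunP => K; rewrite ffunE (bigD1 set0) ?sub0set //=.
rewrite ext_inv0l expr0 mul1r ffunE eqxx mul1r setD0 big1 ?addr0 // => I.
by case/andP=> _ /negbTE I0; rewrite ffunE I0 mul0r mulr0.
Qed.

Lemma ext_mulr1 : right_id (ext_basis set0) ext_mul.
Proof.
move=> a; apply/ffunP => K; rewrite ffunE (bigD1 K) //=.
rewrite setDv ext_inv0r expr0 mul1r ffunE eqxx mulr1 big1 ?addr0 // => I.
case/andP=> IK nIK; rewrite ffunE (_ : (K :\: I == _) = false) ?mulr0 //.
by apply/negbTE; rewrite setD_eq0; apply: contra nIK => KI; rewrite eqEsubset IK.
Qed.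

Lemma ext_mulDl : left_distributive ext_mul +%R.
Proof.
move=> a b c; apply/ffunP => K; rewrite !ffunE -big_split /=.
by apply: eq_bigr => I _; rewrite ffunE mulrDl mulrDr.
Qed.

Lemma ext_mulDr : right_distributive ext_mul +%R.
Proof.
move=> a b c; apply/ffunP => K; rewrite !ffunE -big_split /=.
by apply: eq_bigr => I _; rewrite ffunE mulrDr mulrDr.
Qed.

Lemma ext_1neq0 : ext_basis set0 != 0.
Proof.
apply/eqP => /ffunP/(_ set0); rewrite !ffunE eqxx => /eqP.
by rewrite oner_eq0.
Qed.

HB.instance Definition _ := GRing.Zmodule_isNzRing.Build (ext R n)
  ext_mulA ext_mul1 ext_mulr1 ext_mulDl ext_mulDr ext_1neq0.

Lemma ext_scaleAl (r : R) a b : r *: (a * b) = (r *: a) * b.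
Proof.
apply/ffunP => K; rewrite !ffunE scaler_sumr; apply: eq_bigr => I _.
by rewrite ffunE /GRing.scale /= mulrCA !mulrA.
Qed.

HB.instance Definition _ :=
  GRing.Lmodule_isLalgebra.Build R (ext R n) ext_scaleAl.

Lemma ext_scaleAr (r : R) a b : r *: (a * b) = a * (r *: b).
Proof.
apply/ffunP => K; rewrite !ffunE scaler_sumr; apply: eq_bigr => I _.
by rewrite ffunE /GRing.scale /= mulrCA; congr (_ * _); rewrite mulrCA.
Qed.

HB.instance Definition _ :=
  GRing.Lalgebra_isAlgebra.Build R (ext R n) ext_scaleAr.

Definition ext_gen (i : 'I_n) : ext R n := ext_basis [set i].

Lemma ext_basisM I J : ext_basis I * ext_basis J =
  if [disjoint I & J] then (-1) ^+ ext_inv I J *: ext_basis (I :|: J) else 0.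
Proof.
apply/ffunP => K; rewrite ffunE.
have dE : [disjoint I & J] = (I :&: J == set0) by rewrite setI_eq0.
have [IK|nIK] := boolP (I \subset K); last first.
  rewrite big1 => [|L LK]; last first.
    rewrite ffunE (_ : (L == I) = false) ?mul0r ?mulr0 //.
    by apply: contraNF nIK => /eqP <-.
  case: ifP => _; rewrite !ffunE // (_ : (K == _) = false) ?scaler0 //.
  by apply: contraNF nIK => /eqP ->; apply: subsetUl.
rewrite (bigD1 I) //= big1 => [|L /andP[_ /negbTE LI]]; last first.
  by rewrite ffunE LI mul0r mulr0.
rewrite addr0 !ffunE eqxx mul1r.
have [dIJ|ndIJ] := ifPn; rewrite !ffunE; last first.
  rewrite (_ : (_ == J) = false) ?mulr0 //; apply: contraNF ndIJ => /eqP <-.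
  by rewrite disjoint_sym disjoints_subset setDE subsetIr.
have -> : (K == I :|: J) = (K :\: I == J).
  apply/eqP/eqP => [->|<-]; last by rewrite -[LHS](setID _ I) (setIidPr IK).
  by rewrite setDUl setDv set0U; apply/setDidPl; rewrite disjoint_sym.
have [<-|] := eqVneq (K :\: I) J; last by rewrite mulr0 scaler0.
by [].
Qed.

Lemma ext_gen_sq i : ext_gen i * ext_gen i = 0.
Proof. by rewrite ext_basisM disjoints1 inE eqxx. Qed.

Lemma ext_gen_anti i j : ext_gen i * ext_gen j = - (ext_gen j * ext_gen i).
Proof.
have [->|nij] := eqVneq i j; first by rewrite ext_gen_sq oppr0.
rewrite !ext_basisM !disjoints1 !inE nij eq_sym nij setUC /ext_inv !big_set1.
rewrite -scaleNr; congr (_ *: _).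
by case: (ltngtP i j) nij => [||/val_inj ->]; rewrite ?eqxx //= ?opprK.
Qed.

Lemma ext_basis_prod I : \prod_(i <- enum I) ext_gen i = ext_basis I.
Proof.
have: sorted (fun i j : 'I_n => i < j)%N (enum I).
  rewrite /enum_mem; apply: sorted_filter; first by move=> ? ? ?; apply: ltn_trans.
  by rewrite -enumT; have := iota_ltn_sorted 0 n; rewrite -val_enum_ord sorted_map.
rewrite -[in RHS](set_enum I); elim: (enum I) => [|i s IHs] srt /=.
  by rewrite big_nil; congr ext_basis; apply/setP => x; rewrite !inE.
rewrite big_cons IHs ?(path_sorted srt) // ext_basisM.
have lt_i j : j \in s -> (i < j)%N.
  by move/(order_path_min (fun _ _ _ => @ltn_trans _ _ _))/allP: srt; apply.
rewrite disjoints1 inE.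
case: ifPn => [_|/negbNE/lt_i]; last by rewrite ltnn.
rewrite /ext_inv big_set1 big1 => [|j]; last first.
  by rewrite inE => /lt_i /ltnW; rewrite leqNgt => /negbTE ->.
by rewrite scale1r; congr ext_basis; apply/setP => x; rewrite !inE.
Qed.

(* a \in \Lambda^p *)
Definition ext_homog (p : nat) a := forall I, #|I| != p -> a I = 0.

Definition ext_part (p : nat) a : ext R n :=
  [ffun I : {set 'I_n} => if #|I| == p then a I else 0].

(* The algebra homomorphism e_i |-> w i, when the w i anticommute and square
   to 0. *)
Definition ext_lift (B : algType R) (w : 'I_n -> B) a : B :=
  \sum_(I : {set 'I_n}) a I *: \prod_(i <- enum I) w i.

(* Action of a matrix by g e_j = \sum_i g_ij e_i; for g orthogonal this agrees
   with the contragredient action on the dual space. *)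
Definition ext_act (g : 'M[R]_n) : ext R n -> ext R n :=
  ext_lift (fun j => \sum_i g i j *: ext_gen i).

End ExtRing.
Arguments ext_basis {R n} I.
Arguments ext_gen {R n} i.

From mathcomp Require Import all_classical all_reals all_analysis.
Import numFieldNormedType.Exports.
Local Open Scope classical_set_scope.

Section GradedAlgebra.
Variables (R : realType) (n : nat).
Implicit Types (A : {vspace ext R n}) (G : set 'M[R]_n).

Definition compact_subgroup_O G :=
  [/\ compact G,
      (forall g, G g -> g *m g^T = 1%:M),
      G 1%:M,
      (forall g h, G g -> G h -> G (g *m h))
    & (forall g, G g -> G (invmx g))].

(* 1 \in A is not required. *)
Definition graded_subalgebra A :=
  (forall a b, a \in A -> b \in A -> a * b \in A) /\
  (forall p a, a \in A -> ext_part p a \in A).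

Definition sub_invariants G A :=
  forall g a, G g -> a \in A -> ext_act g a = a.

Definition differential_operator A (f : 'End(subvs_of A)) :=
  [/\ (forall p (a : subvs_of A),
         ext_homog p (vsval a) -> ext_homog p.+1 (vsval (f a))),
      (forall p (a b c : subvs_of A), ext_homog p (vsval a) ->
         vsval c = vsval a * vsval b ->
         vsval (f c) = vsval (f a) * vsval b
                       + (-1) ^+ p *: (vsval a * vsval (f b)))
    & (forall a : subvs_of A, f (f a) = 0)].

Definition derivation1 (h : 'End(ext R n)) :=
  (forall p a, ext_homog p a -> ext_homog p.+1 (h a)) /\
  (forall p a b, ext_homog p a ->
     h (a * b) = h a * b + (-1) ^+ p *: (a * h b)).

Definition extends_op A (f : 'End(subvs_of A)) (h : 'End(ext R n)) :=
  forall a : subvs_of A, h (vsval a) = vsval (f a).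

Definition equivariant G (h : 'End(ext R n)) :=
  forall g a, G g -> h (ext_act g a) = ext_act g (h a).

End GradedAlgebra.

Section Forms.
Variables (R : realType) (N : nat).

(* Differential forms on an open set W of R^N are represented by their
   coefficients in the basis dx_I; values outside W are irrelevant. *)
Definition dform := 'rV[R]_N -> ext R N.

Implicit Types (W : set 'rV[R]_N) (eta : dform) (X : 'rV[R]_N).

Definition pderiv (k : 'I_N) (h : 'rV[R]_N -> R) : 'rV[R]_N -> R :=
  fun x => 'D_(delta_mx 0 k) h x.

Fixpoint Ck_on (m : nat) W (h : 'rV[R]_N -> R) : Prop :=
  (forall x, W x -> {for x, continuous h}) /\
  if m is m'.+1 then
    (forall k x, W x -> derivable h x (delta_mx 0 k)) /\
    (forall k, Ck_on m' W (pderiv k h))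
  else True.

(* eta \in \Omega(W) *)
Definition smooth_form W eta := forall m I, Ck_on m W (fun x => eta x I).

Definition form_d eta : dform := fun x =>
  \sum_(k < N) \sum_(I : {set 'I_N})
    pderiv k (fun y => eta y I) x *: (ext_gen k * ext_basis I).

(* The ideal of \Omega(W) generated by S. *)
Inductive form_ideal W (S : dform -> Prop) : dform -> Prop :=
| Ideal_gen eta : S eta -> form_ideal W S eta
| Ideal_0 : form_ideal W S (fun=> 0)
| Ideal_add eta zeta : form_ideal W S eta -> form_ideal W S zeta ->
    form_ideal W S (fun x => eta x + zeta x)
| Ideal_mull phi eta : smooth_form W phi -> form_ideal W S eta ->
    form_ideal W S (fun x => phi x * eta x)
| Ideal_mulr phi eta : smooth_form W phi -> form_ideal W S eta ->
    form_ideal W S (fun x => eta x * phi x).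

Definition eval1 (a : ext R N) X : R := \sum_k a [set k]%SET * X 0 k.

(* a(v_1, ..., v_k): the coefficient of e_1 ... e_k in the pullback of a by the
   linear map R^k -> R^N sending the basis to v_1, ..., v_k. *)
Definition ext_eval k (a : ext R N) (v : 'I_k -> 'rV[R]_N) : R :=
  (ext_lift (fun j => \sum_s v s 0 j *: ext_gen s) a : ext R k) [set: 'I_k]%SET.

Definition vanishes_on (E : {vspace 'rV[R]_N}) (a : ext R N) :=
  forall k (v : 'I_k -> 'rV[R]_N), (forall s, v s \in E) -> ext_eval a v = 0.

End Forms.

(* All notions below are local on M, so M is taken to be a coordinate domain,
   i.e. an open set U of R^n. Its frame bundle U x GL(n, R) is an open subset
   of R^(n + n * n): the point u has base point lsubmx u, and its frame maps
   e_i to the i-th column of the matrix frame_mx u. Tangent vectors are split in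
   the same way. *)
Section FrameBundle.
Variables (R : realType) (n : nat).

Let N := (n + n * n)%N.

Definition base_pt (u : 'rV[R]_N) : 'rV[R]_n := lsubmx u.
Definition frame_mx (u : 'rV[R]_N) : 'M[R]_n := vec_mx (rsubmx u).
Definition mkF (x : 'rV[R]_n) (g : 'M[R]_n) : 'rV[R]_N := row_mx x (mxvec g).

Definition frame_bundle (U : set 'rV[R]_n) : set 'rV[R]_N :=
  [set u | U (base_pt u) /\ frame_mx u \in unitmx].

(* The right action of h; being linear, it is also its own differential. *)
Definition ract (u : 'rV[R]_N) (h : 'M[R]_n) := mkF (base_pt u) (frame_mx u *m h).

(* \theta_i at u maps X to the i-th component of u^-1 (\pi_* X). *)
Definition theta (i : 'I_n) : dform R N := fun u =>
  \sum_j invmx (frame_mx u) i j *: ext_gen (lshift (n * n) j).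

Definition iotaF (a : ext R n) : dform R N := fun u =>
  ext_lift (fun i => theta i u) a.

Definition mx_eval1 (omega : 'I_n -> 'I_n -> dform R N) u X : 'M[R]_n :=
  \matrix_(i, j) eval1 (omega i j u) X.

Definition connection_form U (omega : 'I_n -> 'I_n -> dform R N) :=
  [/\ (forall i j, smooth_form (frame_bundle U) (omega i j)),
      (forall i j u, frame_bundle U u -> ext_homog 1 (omega i j u)),
      (* omega of the fundamental vector field of B \in gl(n, R) is B *)
      (forall u (B : 'M[R]_n), frame_bundle U u ->
         mx_eval1 omega u (mkF 0 (frame_mx u *m B)) = B)
    & (forall u X (h : 'M[R]_n), frame_bundle U u -> h \in unitmx ->
         mx_eval1 omega (ract u h) (ract X h)
         = invmx h *m mx_eval1 omega u X *m h)].

Definition torsion_free U (omega : 'I_n -> 'I_n -> dform R N) :=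
  forall i u, frame_bundle U u ->
    form_d (theta i) u = - \sum_j omega i j u * theta j u.

Variables (A : {vspace ext R n}) (f : 'End(subvs_of A)).

Definition I_gen (eta : dform R N) :=
  exists a : subvs_of A,
    eta = (fun u => form_d (iotaF (vsval a)) u - iotaF (vsval (f a)) u) \/
    eta = form_d (iotaF (vsval (f a))).

Definition I_Af U : dform R N -> Prop := form_ideal (frame_bundle U) I_gen.

Definition transverse_plane (E : {vspace 'rV[R]_N}) :=
  (\dim E = n)%N /\ forall X, X \in E -> base_pt X = 0 -> X = 0.

(* gl(n, R) \otimes T is the space of matrices p with entries in T:
   p_ijk is p i j 0 k. *)
Definition plane_of (omega : 'I_n -> 'I_n -> dform R N) u (p : 'M['rV[R]_n]_n)
    (E : {vspace 'rV[R]_N}) :=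
  transverse_plane E /\
  forall i j X, X \in E ->
    eval1 (omega i j u) X = \sum_k p i j 0 k * eval1 (theta k u) X.

Definition Z_Af U (omega : 'I_n -> 'I_n -> dform R N) (u : 'rV[R]_N)
    : set 'M['rV[R]_n]_n :=
  [set p | exists E, plane_of omega u p E /\
     forall eta, I_Af U eta -> vanishes_on E (eta u)].

End FrameBundle.

(* Main.v *)
Require Import Defs.
From HB Require Import structures.
From mathcomp Require Import all_boot all_order all_algebra.
From mathcomp Require Import all_classical all_reals all_analysis.
Import Order.TTheory GRing.Theory Num.Theory numFieldNormedType.Exports.
Local Open Scope classical_set_scope.
Local Open Scope ring_scope.
Set Implicit Arguments.
Unset Strict Implicit.
Unset Printing Implicit Defensive.

(** The idea is that of Cartan's exterior differential systems: restricting the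
structure equations of the frame bundle to a plane turns the exterior
derivative into a derivation of the exterior algebra of T.

Let E be the pi-transverse plane at u with coordinates p_ijk.  It has a basis
v_1, ..., v_n dual to the tautological forms, so that pulling back along
e_k |-> v_k is an algebra map r from forms at u to the exterior algebra of T
with r (iota a) = a and r (omega_ij) = \sum_k p_ijk e_k.  A form restricts
to zero on E exactly when r kills it.  Since d is a graded derivation and
d theta_i = - \sum_j omega_ij theta_j, the map D_p := r \o d \o iota is the
degree 1 derivation with D_p e_i = - \sum_jk p_ijk e_k e_j
([conn_deriv_of_plane]).  A derivation is determined by its values on
generators, and those can be prescribed arbitrarily in degree 2; hence p |-> D_p
is linear and onto the degree 1 derivations ([conn_deriv_uniq],
[conn_deriv_lin], [conn_deriv_exists]).

The forms d (iota a) - iota (f a) lie in the ideal, so E is an integral plane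
only if D_p a = f a for all a \in A; conversely this gives D_p (f a) = f (f a) = 0
and so r kills all generators, hence the whole ideal ([Z_AfP]).  The set Z_(A,f)
is thus an inhomogeneous linear system in p: it is nonempty iff f extends, and
then it is a translate of the solution set Z_(A,0) of the homogeneous one.

For equivariance, O(n) acts on the tensors p isometrically, with
D_(g p) = g D_p g^-1 ([conn_deriv_act], [conn_act_isometry]).  As G fixes A
pointwise, it preserves the affine space of all p for which D_p extends f.
That space has a unique shortest element ([unique_shortest]), which G must
therefore fix; its derivation is equivariant ([equivariant_extension]). *)

(** * The exterior algebra: grading, commutation, universal property *)

Section ExteriorAlgebra.
Variables (R : comNzRingType) (n : nat).
Implicit Types (a b c : ext R n) (I J K : {set 'I_n}).

Lemma ext_expand a : a = \sum_I a I *: (ext_basis I : ext R n).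
Proof.
apply/ffunP => K; rewrite sum_ffunE (bigD1 K) //= big1 => [|I /negbTE nIK].
  by rewrite addr0 !ffunE eqxx /GRing.scale /= mulr1.
by rewrite !ffunE eq_sym nIK scaler0.
Qed.

Lemma ext_basis0 : ext_basis finset.set0 = 1 :> ext R n.
Proof. by []. Qed.

Lemma ext_mulE a b K : (a * b) K =
  \sum_(I : {set 'I_n} | I \subset K)
     (-1) ^+ ext_inv I (K :\: I) * (a I * b (K :\: I)).
Proof. by rewrite ffunE. Qed.

Lemma enum_setU1_min (i : 'I_n) J :
  (forall j, j \in J -> (i < j)%N) -> enum (i |: J)%SET = i :: enum J.
Proof.
have srt (K : {set 'I_n}) : sorted (fun i j : 'I_n => i < j)%N (enum K).
  rewrite /enum_mem; apply: sorted_filter; first by move=> ? ? ?; apply: ltn_trans.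
  by rewrite -enumT; have := iota_ltn_sorted 0 n; rewrite -val_enum_ord sorted_map.
move=> ltJ.
apply: (@irr_sorted_eq _ (fun i j : 'I_n => i < j)%N) => //.
- by move=> ? ? ?; apply: ltn_trans.
- by move=> ?; apply: ltnn.
- rewrite /= path_min_sorted //; apply/allP => j; rewrite mem_enum; exact: ltJ.
- by move=> j; rewrite inE !mem_enum !inE.
Qed.

Lemma ext_basis_set1M (i : 'I_n) J : i \in J -> ext_gen i * ext_basis J = 0 :> ext R n.
Proof. by move=> iJ; rewrite /ext_gen ext_basisM disjoints1 iJ. Qed.

Lemma ext_basis_min (i : 'I_n) J : (forall j, j \in J -> (i < j)%N) ->
  ext_basis (i |: J)%SET = ext_gen i * ext_basis J :> ext R n.
Proof.
by move=> ltJ; rewrite -!ext_basis_prod enum_setU1_min // big_cons.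
Qed.

(** Adding elements in decreasing order matches the increasing order of the
factors of a basis monomial: each step is a left multiplication by a generator
without sign ([ext_basis_min]). *)
Lemma ext_set_ind (P : {set 'I_n} -> Prop) : P finset.set0 ->
  (forall (i : 'I_n) J, (forall j, j \in J -> (i < j)%N) -> P J -> P (i |: J)%SET) ->
  forall J, P J.
Proof.
move=> P0 PU J; elim: {J}_.+1 {-2}J (ltnSn #|J|) => // m IHm J leJm.
have [->//|[j0 j0J]] := set_0Vmem J.
have [i iJ leJ] := arg_minnP (fun i : 'I_n => val i) j0J.
rewrite -(finset.setD1K iJ); apply: PU => [j|].
  by rewrite !inE => /andP[nji /leJ]; rewrite leq_eqVlt => /predU1P[/val_inj E|//];
    rewrite E eqxx in nji.
by apply: IHm; move: leJm; rewrite (cardsD1 i J) (_ : i \in J).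
Qed.

Lemma ext_homogM p q a b :
  ext_homog p a -> ext_homog q b -> ext_homog (p + q) (a * b).
Proof.
move=> ha hb K nK; rewrite ext_mulE big1 // => I IK.
have [cI|/ha->] := eqVneq #|I| p; last by rewrite mul0r mulr0.
rewrite hb ?mulr0 //; apply: contraNneq nK => cKI.
by rewrite -cKI -cI -(cardsID I K) (finset.setIidPr IK).
Qed.

Lemma ext_homog0 p : ext_homog p (0 : ext R n).
Proof. by move=> I _; rewrite ffunE. Qed.

Lemma ext_homogD p a b : ext_homog p a -> ext_homog p b -> ext_homog p (a + b).
Proof. by move=> ha hb I nI; rewrite ffunE ha ?hb ?addr0. Qed.

Lemma ext_homogZ p (k : R) a : ext_homog p a -> ext_homog p (k *: a).
Proof. by move=> ha I nI; rewrite ffunE ha ?scaler0. Qed.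

Lemma ext_homog_sum p (T : finType) (P : pred T) (F : T -> ext R n) :
  (forall t, P t -> ext_homog p (F t)) -> ext_homog p (\sum_(t | P t) F t).
Proof.
by move=> hF; elim/big_ind: _ => //; [apply: ext_homog0 | apply: ext_homogD].
Qed.

Lemma ext_homog_basis I : ext_homog #|I| (ext_basis I : ext R n).
Proof.
move=> J nJ; rewrite ffunE (_ : J == I = false) //.
by apply: contraNF nJ => /eqP->.
Qed.

Lemma ext_homog_gen (i : 'I_n) : ext_homog 1 (ext_gen i : ext R n).
Proof. by rewrite -(cards1 i); apply: ext_homog_basis. Qed.

Lemma ext_genC (i : 'I_n) p a : ext_homog p a ->
  ext_gen i * a = (-1) ^+ p *: (a * ext_gen i).
Proof.
move=> ha; rewrite (ext_expand a) mulr_sumr mulr_suml scaler_sumr.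
apply: eq_bigr => J _; have [<-|/ha->] := eqVneq #|J| p; last first.
  by rewrite scale0r mul0r mulr0 scaler0.
rewrite -scalerAr -scalerAl scalerA mulrC -scalerA; congr (_ *: _).
elim/ext_set_ind: J => [|j J ltJ IH]; first by rewrite cards0 scale1r mulr1 mul1r.
have njJ : j \notin J by apply/negP => /ltJ; rewrite ltnn.
rewrite cardsU1 njJ ext_basis_min // mulrA ext_gen_anti mulNr -mulrA IH.
by rewrite -scalerAr mulrA add1n exprS mulN1r scaleNr.
Qed.

(** Derivations along phi, not just along the identity, so that g D and D g can
be compared for a substitution g.  The Leibniz rule for a generator on the left
is enough, as every monomial is reached by such products. *)
Lemma ext_derivation_uniq (B : algType R) (phi d d' : {linear ext R n -> B}) :
  phi 1 = 1 ->
  (forall i b, d (ext_gen i * b) = d (ext_gen i) * phi b - phi (ext_gen i) * d b) ->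
  (forall i b, d' (ext_gen i * b) = d' (ext_gen i) * phi b - phi (ext_gen i) * d' b) ->
  d 1 = 0 -> d' 1 = 0 ->
  (forall i, d (ext_gen i) = d' (ext_gen i)) -> d =1 d'.
Proof.
move=> phi1 dM d'M d1 d'1 dE a; rewrite (ext_expand a) !linear_sum.
apply: eq_bigr => J _; rewrite !linearZ; congr (_ *: _) => /=.
elim/ext_set_ind: J => [|i J ltJ IH]; first by rewrite ext_basis0 d1 d'1.
by rewrite ext_basis_min // dM d'M dE IH.
Qed.

End ExteriorAlgebra.

Section Lift.
Variables (R : comNzRingType) (n : nat) (B : algType R) (w : 'I_n -> B).

Lemma ext_lift_is_linear : linear (ext_lift w).
Proof.
move=> k a b; rewrite /ext_lift scaler_sumr -big_split /=.
by apply: eq_bigr => I _; rewrite !ffunE scalerDl scalerA.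
Qed.

HB.instance Definition _ :=
  GRing.isLinear.Build R (ext R n) B *:%R (ext_lift w) ext_lift_is_linear.

Lemma ext_lift_basis I : ext_lift w (ext_basis I) = \prod_(i <- enum I) w i.
Proof.
rewrite /ext_lift (bigD1 I) //= [X in _ + X]big1 ?addr0 => [|J /negbTE nJI].
  by rewrite ffunE eqxx scale1r.
by rewrite ffunE nJI scale0r.
Qed.

Lemma ext_lift1 : ext_lift w 1 = 1.
Proof. by rewrite -ext_basis0 ext_lift_basis enum_set0 big_nil. Qed.

Lemma ext_lift_gen i : ext_lift w (ext_gen i) = w i.
Proof. by rewrite ext_lift_basis enum_set1 big_seq1. Qed.

Lemma ext_lift_basis_min (i : 'I_n) (J : {set 'I_n}) : (forall j, j \in J -> (i < j)%N) ->
  ext_lift w (ext_basis (i |: J)%SET) = w i * ext_lift w (ext_basis J).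
Proof. by move=> ltJ; rewrite !ext_lift_basis enum_setU1_min // big_cons. Qed.

Hypothesis w_sq : forall i, w i * w i = 0.
Hypothesis w_anti : forall i j, w i * w j = - (w j * w i).

(** This is where the order of the factors matters.  A generator that comes
before all of J extends the monomial; one that comes later is moved past the
first factor of J, on both sides at the cost of one sign. *)
Lemma ext_lift_genM i b : ext_lift w (ext_gen i * b) = w i * ext_lift w b.
Proof.
rewrite (ext_expand b) mulr_sumr !linear_sum mulr_sumr; apply: eq_bigr => J _ /=.
rewrite -scalerAr !linearZ -scalerAr; congr (_ *: _) => /=.
elim/ext_set_ind: J => [|j J ltJ IH].
  by rewrite ext_basis0 mulr1 ext_lift1 mulr1 ext_lift_gen.
rewrite ext_lift_basis_min //.
have [ltij|ltji|/val_inj->] := ltngtP i j; last 1 first.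
- by rewrite ext_basis_set1M ?inE ?eqxx // linear0 mulrA w_sq mul0r.
- have lti k : k \in (j |: J)%SET -> (i < k)%N.
    by rewrite !inE => /predU1P[-> //|/ltJ]; apply: ltn_trans.
  by rewrite -ext_basis_min ?(ext_lift_basis_min lti) // ext_lift_basis_min.
rewrite ext_basis_min // mulrA ext_gen_anti mulNr -mulrA linearN /=.
rewrite [RHS]mulrA w_anti mulNr -[in RHS]mulrA -IH /ext_gen ext_basisM.
case: ifP => _; last by rewrite mulr0 !linear0 mulr0 oppr0.
rewrite -ext_scaleAr; congr (- _); rewrite !linearZ /= -scalerAr -ext_lift_basis_min.
  rewrite -ext_basis_min // => k.
  by rewrite !inE => /orP[/eqP-> //|/ltJ].
by move=> k; rewrite !inE => /orP[/eqP-> //|/ltJ].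
Qed.

(** The universal property of the exterior algebra: [ext_lift] is defined on the
monomials, and the relations between the w i make it multiplicative. *)
Lemma ext_liftM a b : ext_lift w (a * b) = ext_lift w a * ext_lift w b.
Proof.
rewrite (ext_expand a) mulr_suml !linear_sum mulr_suml; apply: eq_bigr => J _ /=.
rewrite -scalerAl !linearZ -scalerAl; congr (_ *: _) => /=.
elim/ext_set_ind: J => [|j J ltJ IH]; first by rewrite ext_basis0 ext_lift1 !mul1r.
by rewrite ext_basis_min // -mulrA !ext_lift_genM IH mulrA.
Qed.

End Lift.

Section LinearSubstitution.
Variables (R : comNzRingType) (n m : nat).

Lemma ext_deg1_anti (x y : ext R m) : ext_homog 1 x -> ext_homog 1 y -> x * y = - (y * x).
Proof.
move=> hx hy; rewrite (ext_expand x) mulr_suml mulr_sumr -sumrN.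
apply: eq_bigr => I _; have [/eqP/cards1P[i ->]|/hx->] := eqVneq #|I| 1%N; last first.
  by rewrite scale0r mul0r mulr0 oppr0.
by rewrite -scalerAl -scalerAr (ext_genC _ hy) expr1 scaleN1r scalerN.
Qed.


Lemma ext_deg1_expand (x : ext R m) :
  ext_homog 1 x -> x = \sum_i x [set i]%SET *: ext_gen i.
Proof.
move=> hx; apply/ffunP => K; rewrite sum_ffunE.
have [/eqP/cards1P[k ->]|nK] := eqVneq #|K| 1%N.
  rewrite (bigD1 k) //= big1 => [|i nik].
    by rewrite addr0 !ffunE eqxx /GRing.scale /= mulr1.
  by rewrite !ffunE (inj_eq set1_inj) eq_sym (negbTE nik) scaler0.
rewrite hx // big1 // => i _; rewrite !ffunE (_ : K == _ = false) ?scaler0 //.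
by apply: contraNF nK => /eqP->; rewrite cards1.
Qed.

Lemma ext_lift_homog (w : 'I_n -> ext R m) p a :
  (forall i, ext_homog 1 (w i)) -> ext_homog p a -> ext_homog p (ext_lift w a).
Proof.
move=> hw ha; apply: ext_homog_sum => I _.
have [<-|/ha->] := eqVneq #|I| p; last by rewrite scale0r; apply: ext_homog0.
apply: ext_homogZ; rewrite cardE; elim: (enum I) => [|i s IHs] /=.
  by rewrite big_nil -(@cards0 'I_m); apply: ext_homog_basis.
by rewrite big_cons -add1n; apply: ext_homogM.
Qed.

Lemma ext_lift_comp (B : algType R) (v : 'I_n -> ext R m) (w : 'I_m -> B) a :
  (forall i, w i * w i = 0) -> (forall i j, w i * w j = - (w j * w i)) ->
  ext_lift w (ext_lift v a) = ext_lift (fun i => ext_lift w (v i)) a.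
Proof.
move=> w_sq w_anti; rewrite {1}/ext_lift -/(ext_lift w _) linear_sum.
apply: eq_bigr => I _; rewrite linearZ; congr (_ *: _) => /=.
elim: (enum I) => [|i s IHs]; first by rewrite !big_nil ext_lift1.
by rewrite !big_cons ext_liftM // IHs.
Qed.

Lemma ext_lift_ext_gen a : ext_lift (@ext_gen R n) a = a.
Proof.
by rewrite [RHS]ext_expand; apply: eq_bigr => I _; rewrite ext_basis_prod.
Qed.

Lemma ext_lift_eq (B : algType R) (w w' : 'I_n -> B) a :
  w =1 w' -> ext_lift w a = ext_lift w' a.
Proof. by move=> ww'; congr ext_lift; apply/funext. Qed.

End LinearSubstitution.

Section LinearSubstitutionR.
Variables (R : numFieldType) (n m : nat).

Lemma ext_deg1_sq k (x : ext R k) : ext_homog 1 x -> x * x = 0.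
Proof.
move=> hx; apply/eqP; have /eqP := ext_deg1_anti hx hx.
by rewrite -addr_eq0 -mulr2n -scaler_nat scaler_eq0 pnatr_eq0.
Qed.

Lemma ext_lift_deg1M (w : 'I_n -> ext R m) a b : (forall i, ext_homog 1 (w i)) ->
  ext_lift w (a * b) = ext_lift w a * ext_lift w b.
Proof.
by move=> hw; apply: ext_liftM => [i|i j]; [apply: ext_deg1_sq | apply: ext_deg1_anti].
Qed.

Lemma ext_lift_deg1_comp k (v : 'I_n -> ext R m) (w : 'I_m -> ext R k) a :
  (forall i, ext_homog 1 (w i)) ->
  ext_lift w (ext_lift v a) = ext_lift (fun i => ext_lift w (v i)) a.
Proof.
by move=> hw; apply: ext_lift_comp => [i|i j]; [apply: ext_deg1_sq | apply: ext_deg1_anti].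
Qed.

(** The wedge pairing of complementary degrees is perfect.  It lets the values
of forms of the ideal on n vectors detect all coefficients of a form on an
n-plane. *)
Lemma ext_top_nondeg (a : ext R n) :
  (forall b : ext R n, (a * b) [set: 'I_n]%SET = 0) -> a = 0.
Proof.
move=> a0; apply/ffunP => I; rewrite ffunE.
move: (a0 (ext_basis (~: I)%SET)); rewrite ext_mulE (bigD1 I) ?finset.subsetT //=.
rewrite big1 => [|J /andP[_ nJI]].
  rewrite addr0 finset.setTD ffunE eqxx mulr1 => /eqP.
  by rewrite mulrI_eq0 ?signr_eq0 => [/eqP //|]; apply/lregP; rewrite signr_eq0.
rewrite ffunE finset.setTD (inj_eq (@finset.setC_inj _)) (negbTE nJI).
by rewrite mulr0 mulr0.
Qed.

Lemma ext_deg2_expand (a : ext R n) : ext_homog 2 a ->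
  exists t : 'I_n -> 'I_n -> R, a = \sum_j \sum_k t j k *: (ext_gen k * ext_gen j).
Proof.
move=> ha; rewrite (ext_expand a).
elim/big_ind: _ => [|_ _ [s ->] [t ->]|I _].
- exists (fun _ _ => 0); rewrite big1 // => j _; rewrite big1 // => k _.
  by rewrite scale0r.
- exists (fun j k => s j k + t j k); rewrite -big_split; apply: eq_bigr => j _ /=.
  by rewrite -big_split; apply: eq_bigr => k _ /=; rewrite scalerDl.
have [/eqP/cards2P[x [y [nxy ->]]]|/ha->] := eqVneq #|I| 2%N; last first.
  exists (fun _ _ => 0); rewrite scale0r big1 // => j _; rewrite big1 // => k _.
  by rewrite scale0r.
set c := a _; pose s : R := (-1) ^+ ext_inv [set x] [set y].
exists (fun j k => ((j == y) && (k == x))%:R * (c * s)).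
rewrite (bigD1 y) //= [X in _ + X]big1 ?addr0 => [|j /negbTE->]; last first.
  by rewrite big1 // => k _; rewrite mul0r scale0r.
rewrite (bigD1 x) //= [X in _ + X]big1 ?addr0 => [|j /negbTE->]; last first.
  by rewrite andbF mul0r scale0r.
rewrite !eqxx mul1r ext_basisM disjoints1 inE nxy -/s scalerA -mulrA.
by rewrite -expr2 sqrr_sign mulr1.
Qed.

End LinearSubstitutionR.

(** * Shortest vectors of affine subspaces *)

Section ShortestVector.
Variables (R : realFieldType) (V : vectType R) (dot : V -> V -> R).
Hypothesis dotC : forall x y, dot x y = dot y x.
Hypothesis dotD : forall x y z, dot (x + y) z = dot x z + dot y z.
Hypothesis dotZ : forall k x y, dot (k *: x) y = k * dot x y.
Hypothesis dot_gt0 : forall x, x != 0 -> 0 < dot x x.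

Lemma orthogonal_projection (W : {vspace V}) p :
  exists2 w, w \in W & forall x, x \in W -> dot (p - w) x = 0.
Proof.
have dotZr k x y : dot x (k *: y) = k * dot x y by rewrite dotC dotZ dotC.
have dotDr x y z : dot x (y + z) = dot x y + dot x z.
  by rewrite dotC dotD !(dotC _ x).
have dotNl x y : dot (- x) y = - dot x y by rewrite -scaleN1r dotZ mulN1r.
rewrite -(span_basis (vbasisP W)).
elim: (vbasis W : seq V) p => [|x X IH] p.
  exists 0; first exact: mem0v.
  move=> x; rewrite span_nil memv0 => /eqP->.
  by rewrite -(scale0r 0) dotZr mul0r.
(* Gram-Schmidt step: x' is the part of x orthogonal to the span of X. *)
have [wx wxX /= wx0] := IH x; have [w wX w0] := IH p.
set x' := x - wx in wx0.
have [x'0|nx'0] := eqVneq x' 0.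
  have xX : x \in <<X>>%VS by rewrite -(subrK wx x) -/x' x'0 add0r.
  suff -> : <<x :: X>>%VS = <<X>>%VS by exists w.
  by rewrite span_cons; apply/addv_idPr; rewrite -memvE.
set t := dot (p - w) x' / dot x' x'.
have sub y : y \in <<X>>%VS -> y \in <<x :: X>>%VS.
  by apply: subvP; rewrite span_cons addvSr.
exists (w + t *: x').
  apply: memvD; first exact: sub.
  apply: memvZ; apply: memvB; last exact: sub.
  by rewrite memv_span ?mem_head.
have tx' : dot (p - (w + t *: x')) x' = 0.
  rewrite opprD addrA dotD dotNl dotZ /t mulfVK ?subrr //.
  by rewrite gt_eqF // dot_gt0.
have tX y : y \in <<X>>%VS -> dot (p - (w + t *: x')) y = 0.
  by move=> yX; rewrite opprD addrA dotD dotNl dotZ w0 // wx0 // mulr0 subr0.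
move=> y; rewrite span_cons => /memv_addP[_ /vlineP[k ->] [z zX ->]].
rewrite dotDr dotZr -(subrK wx x) -/x' dotDr tx' add0r !tX //.
by rewrite mulr0 addr0.
Qed.

(** Any q' in p + W is q plus a vector of W orthogonal to q, so that equal
length forces equality by Pythagoras.  In this form an isometry preserving
p + W visibly fixes q. *)
Lemma unique_shortest (W : {vspace V}) p :
  exists2 q, q - p \in W &
    forall q', q' - p \in W -> dot q' q' = dot q q -> q' = q.
Proof.
have [w wW w0] := orthogonal_projection W p.
exists (p - w); first by rewrite addrC addKr memvN.
move=> q' q'W eqd; set q := p - w in w0 eqd *.
have dW : q' - q \in W by rewrite /q opprB addrCA addrC memvD.
clearbody q.
apply/eqP; rewrite -subr_eq0; apply/negPn/negP => /dot_gt0 d0.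
have: dot q' q' = dot (q' - q) (q' - q) + dot q q.
  move: (w0 _ dW); set d := q' - q => q0.
  have -> : q' = d + q by rewrite subrK.
  clearbody d.
  by rewrite dotD (dotC d (d + q)) (dotC q (d + q)) !dotD (dotC d q) q0 addr0 add0r.
by move=> /eqP; rewrite eqd -subr_eq0 opprD addrCA subrr addr0 oppr_eq0 gt_eqF.
Qed.

End ShortestVector.

(** * Derivations of degree 1 and their connection coefficients *)

Section Derivations.
Variables (R : realType) (n : nat).
Implicit Types (P Q : {ffun 'I_n -> 'M[R]_n}) (g : 'M[R]_n) (h : 'End(ext R n)).

(** The tensor p_ijk is encoded as P k i j: the matrix P k is the value of the
connection form on the k-th basis vector of the plane.  The formula is the
restriction of d theta_i = - \sum_j omega_ij theta_j to that plane. *)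
Definition conn_deriv P h := derivation1 h /\
  forall i, h (ext_gen i) = - \sum_j \sum_k P k i j *: (ext_gen k * ext_gen j).

Lemma derivation1_genM h i b : derivation1 h ->
  h (ext_gen i * b) = h (ext_gen i) * b - ext_gen i * h b.
Proof. by case=> _ hM; rewrite (hM 1%N) ?expr1 ?scaleN1r //; apply: ext_homog_gen. Qed.

Lemma derivation1_1 h : derivation1 h -> h 1 = 0.
Proof.
move=> [_ hM].
have h0 : ext_homog 0 (1 : ext R n) by rewrite -(@cards0 'I_n); apply: ext_homog_basis.
have := hM 0%N 1 1 h0.
by rewrite !mul1r !mulr1 expr0 scale1r => /eqP; rewrite -subr_eq subrr eq_sym => /eqP.
Qed.

Lemma conn_deriv_uniq P h h' : conn_deriv P h -> conn_deriv P h' -> h = h'.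
Proof.
move=> [dh hE] [dh' h'E]; apply/lfunP.
apply: (@ext_derivation_uniq R n (ext R n) idfun h h') => /=.
- by [].
- by move=> i b; rewrite derivation1_genM.
- by move=> i b; rewrite derivation1_genM.
- exact: derivation1_1.
- exact: derivation1_1.
- by move=> i; rewrite hE h'E.
Qed.

(** The products e_k e_j span degree 2, so suitable coefficients exist; they are
not unique, the part symmetric in j and k being arbitrary. *)
Lemma conn_deriv_exists h : derivation1 h -> exists P, conn_deriv P h.
Proof.
move=> dh.
have tP i : exists t : 'I_n -> 'I_n -> R,
    h (ext_gen i) = \sum_j \sum_k t j k *: (ext_gen k * ext_gen j).
  by apply: ext_deg2_expand; apply: dh.1; apply: ext_homog_gen.
pose t i := projT1 (cid (tP i)).
exists [ffun k => \matrix_(i, j) - t i j k]; split=> // i.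
rewrite (projT2 (cid (tP i))) -sumrN; apply: eq_bigr => j _.
by rewrite -sumrN; apply: eq_bigr => k _; rewrite ffunE mxE scaleNr opprK.
Qed.

Lemma conn_deriv_lin (k : R) P Q h h' : conn_deriv P h -> conn_deriv Q h' ->
  conn_deriv (k *: P + Q) (k *: h + h').
Proof.
move=> [[hd hM] hE] [[h'd h'M] h'E]; split; first split.
- move=> p a pa; rewrite add_lfunE scale_lfunE.
  by apply: ext_homogD; [apply: ext_homogZ; apply: hd | apply: h'd].
- move=> p a b pa; rewrite !add_lfunE !scale_lfunE (hM p) // (h'M p) //.
  rewrite mulrDl mulrDr !scalerDr -!scalerAl -!scalerAr !scalerA.
  by rewrite addrACA [k * _]mulrC.
move=> i; rewrite add_lfunE scale_lfunE hE h'E scalerN -opprD scaler_sumr.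
rewrite -big_split; congr (- _); apply: eq_bigr => j _ /=.
rewrite scaler_sumr -big_split; apply: eq_bigr => l _ /=.
by rewrite scalerA -scalerDl !ffunE !mxE.
Qed.

Definition conn_dot P Q := \sum_i \sum_j \sum_k P k i j * Q k i j.

Lemma conn_dot_gt0 P : P != 0 -> 0 < conn_dot P P.
Proof.
move=> nP0.
have entry_ge0 i j k : 0 <= P k i j * P k i j by rewrite -expr2 sqr_ge0.
have row_ge0 i j : 0 <= \sum_k P k i j * P k i j by apply: sumr_ge0.
have slice_ge0 i : 0 <= \sum_j \sum_k P k i j * P k i j by apply: sumr_ge0.
rewrite lt0r sumr_ge0 // andbT; apply: contraNneq nP0 => P0.
apply/eqP/ffunP => k; apply/matrixP => i j; rewrite ffunE mxE.
have slice0 := psumr_eq0P (fun i _ => slice_ge0 i) P0 (i := i) isT.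
have row0 := psumr_eq0P (fun j _ => row_ge0 i j) slice0 (i := j) isT.
have /eqP := psumr_eq0P (fun k _ => entry_ge0 i j k) row0 (i := k) isT.
by rewrite mulf_eq0 orbb => /eqP.
Qed.

(** The action of O(n) on the third tensor power of T. *)
Definition conn_act g P : {ffun 'I_n -> 'M[R]_n} :=
  [ffun c => \matrix_(a, b)
     \sum_i g a i * (\sum_j g b j * (\sum_k g c k * P k i j))].

Lemma orthogonal_sum g (x : 'I_n -> R) : g *m g^T = 1%:M ->
  \sum_a (\sum_i g a i * x i) ^+ 2 = \sum_i x i ^+ 2.
Proof.
move=> /mulmx1C gTg; pose X := \col_i x i.
have -> : \sum_i x i ^+ 2 = ((g *m X)^T *m (g *m X)) 0 0.
  rewrite trmx_mul mulmxA -(mulmxA _ g^T) gTg mulmx1 mxE.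
  by apply: eq_bigr => i _; rewrite !mxE.
rewrite mxE; apply: eq_bigr => a _; rewrite !mxE expr2.
by congr (_ * _); apply: eq_bigr => i _; rewrite !mxE.
Qed.

(** Orthogonality is used for one tensor index at a time, after moving the sum
over that index to the innermost place. *)
Lemma conn_act_isometry g P : g *m g^T = 1%:M ->
  conn_dot (conn_act g P) (conn_act g P) = conn_dot P P.
Proof.
move=> gg; rewrite /conn_dot.
transitivity (\sum_b \sum_c \sum_i (\sum_j g b j * (\sum_k g c k * P k i j)) ^+ 2).
  rewrite exchange_big; apply: eq_bigr => b _.
  rewrite exchange_big; apply: eq_bigr => c _ /=.
  by rewrite -[RHS](orthogonal_sum _ gg); apply: eq_bigr => a _; rewrite ffunE mxE.
rewrite exchange_big.
under eq_bigr do rewrite exchange_big.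
transitivity (\sum_c \sum_i \sum_j (\sum_k g c k * P k i j) ^+ 2).
  apply: eq_bigr => c _; apply: eq_bigr => i _.
  by rewrite -[RHS](orthogonal_sum _ gg).
rewrite exchange_big; apply: eq_bigr => i _.
rewrite exchange_big; apply: eq_bigr => j _ /=.
by rewrite -[RHS](orthogonal_sum _ gg); apply: eq_bigr => k _.
Qed.

HB.instance Definition _ g := GRing.Linear.copy (ext_act g) (ext_act g).

Lemma ext_act_homog_gen g j : ext_homog 1 (\sum_i g i j *: ext_gen i : ext R n).
Proof. by apply: ext_homog_sum => i _; apply: ext_homogZ; apply: ext_homog_gen. Qed.

Lemma ext_actM g (a b : ext R n) : ext_act g (a * b) = ext_act g a * ext_act g b.
Proof. by apply: ext_lift_deg1M; apply: ext_act_homog_gen. Qed.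

Lemma ext_act_gen g j : ext_act g (ext_gen j) = \sum_i g i j *: ext_gen i.
Proof. by rewrite /ext_act ext_lift_gen. Qed.

(** D_(g p) g = g D_p: both sides are derivations along g, and on e_i the factor
g_ai brought in by g e_i contracts with the one for the first index of g p, by
g^T g = 1. *)
Lemma conn_deriv_act g P h h' : g *m g^T = 1%:M ->
  conn_deriv P h -> conn_deriv (conn_act g P) h' ->
  forall a, h' (ext_act g a) = ext_act g (h a).
Proof.
move=> /mulmx1C gTg [dh hE] [dh' h'E].
apply: (@ext_derivation_uniq R n (ext R n) (ext_act g) (h' \o ext_act g) (ext_act g \o h)).
- exact: ext_lift1.
- move=> i b /=; rewrite ext_actM (dh'.2 1%N) ?expr1 ?scaleN1r //.
  by rewrite ext_act_gen; apply: ext_act_homog_gen.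
- by move=> i b /=; rewrite derivation1_genM // linearB /= !ext_actM.
- by rewrite /= /ext_act ext_lift1 derivation1_1.
- by rewrite /= derivation1_1 // linear0.
move=> i /=; rewrite hE ext_act_gen linear_sum [RHS]linearN [X in _ = - X]linear_sum /=.
under eq_bigr do rewrite linearZ /= h'E scalerN scaler_sumr /=.
rewrite sumrN; congr (- _); rewrite exchange_big /=.
transitivity (\sum_b \sum_c (\sum_j g b j * (\sum_k g c k * P k i j)) *:
    (ext_gen c * ext_gen b : ext R n)).
  apply: eq_bigr => b _; under eq_bigr do rewrite scaler_sumr.
  rewrite exchange_big; apply: eq_bigr => c _ /=.
  under eq_bigr do rewrite scalerA.
  rewrite -scaler_suml; congr (_ *: _).
  pose y l := \sum_j g b j * (\sum_k g c k * P k l j).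
  transitivity (\sum_l (g^T *m g) i l * y l).
    under [RHS]eq_bigr do rewrite mxE mulr_suml.
    rewrite exchange_big; apply: eq_bigr => a _ /=.
    rewrite !ffunE mxE mulr_sumr; apply: eq_bigr => l _.
    by rewrite mxE mulrA.
  rewrite gTg (bigD1 i) //= big1 ?addr0 => [|l nli]; first by rewrite mxE eqxx mul1r.
  by rewrite mxE eq_sym (negbTE nli) mul0r.
under [LHS]eq_bigr => b _ do under eq_bigr => c _ do rewrite scaler_suml.
transitivity (\sum_j \sum_b \sum_c (g b j * \sum_k g c k * P k i j) *:
    (ext_gen c * ext_gen b : ext R n)).
  under [LHS]eq_bigr do rewrite exchange_big.
  by rewrite exchange_big.
apply: eq_bigr => j _; rewrite linear_sum /=.
under [RHS]eq_bigr => k _ do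
  rewrite linearZ /= ext_actM !ext_act_gen mulr_sumr scaler_sumr.
rewrite [RHS]exchange_big; apply: eq_bigr => b _ /=.
under [RHS]eq_bigr => k _ do rewrite mulr_suml scaler_sumr.
rewrite [RHS]exchange_big; apply: eq_bigr => c _ /=.
rewrite mulr_sumr scaler_suml; apply: eq_bigr => k _.
rewrite -[X in _ = _ *: X]scalerAl -[X in _ = _ *: (_ *: X)]scalerAr !scalerA.
by rewrite [in RHS]mulrC [P k i j * _]mulrC.
Qed.

End Derivations.

(** * Exterior derivative of products of forms *)

Section ExteriorDerivative.
Variables (R : realType) (N : nat).
Implicit Types (eta zeta : dform R N) (u v : 'rV[R]_N).

(** Directional derivability of all coefficients suffices for the product rule,
and passes from a function to one that agrees with it near u. *)
Definition form_derivable u eta :=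
  forall v I, derivable (fun y => eta y I : R) u v.

Definition form_deriv v eta u : ext R N :=
  [ffun I : {set 'I_N} => 'D_v (fun y => eta y I : R) u].

Definition form_pderiv k eta u := form_deriv (delta_mx 0 k) eta u.

Lemma form_dE eta u : form_d eta u = \sum_k ext_gen k * form_pderiv k eta u.
Proof.
apply: eq_bigr => k _; rewrite (ext_expand (form_pderiv _ _ _)) mulr_sumr.
by apply: eq_bigr => I _; rewrite -scalerAr ffunE.
Qed.

Lemma form_derivable_lin (c : R) eta zeta u :
  form_derivable u eta -> form_derivable u zeta ->
  form_derivable u (fun y => c *: eta y + zeta y).
Proof.
move=> de dz v I.
rewrite (_ : (fun y => _) = c \*: (fun y => eta y I : R) + (fun y => zeta y I : R)).
  by apply: derivableD; [apply: derivableZ|].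
by apply/funext => y; rewrite !ffunE.
Qed.

Lemma form_pderiv_lin k (c : R) eta zeta u :
  form_derivable u eta -> form_derivable u zeta ->
  form_pderiv k (fun y => c *: eta y + zeta y) u =
  c *: form_pderiv k eta u + form_pderiv k zeta u.
Proof.
move=> de dz; apply/ffunP => I; rewrite !ffunE /pderiv.
rewrite (_ : (fun y => _) = c \*: (fun y => eta y I : R) + (fun y => zeta y I : R)).
  by rewrite deriveD ?deriveZ //; apply: derivableZ.
by apply/funext => y; rewrite !ffunE.
Qed.

Lemma form_d_lin (c : R) eta zeta u :
  form_derivable u eta -> form_derivable u zeta ->
  form_d (fun y => c *: eta y + zeta y) u = c *: form_d eta u + form_d zeta u.
Proof.
move=> de dz; rewrite !form_dE scaler_sumr -big_split; apply: eq_bigr => k _ /=.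
by rewrite form_pderiv_lin // mulrDr scalerAr.
Qed.

Lemma form_derivable_cst a u : form_derivable u (fun=> a).
Proof. by move=> v I; apply: derivable_cst. Qed.

Lemma is_derive_scaledM (f g : 'rV[R]_N -> R) (s : R) u v :
  derivable f u v -> derivable g u v ->
  is_derive u v (fun y => s * (f y * g y))
    (s * ('D_v f u * g u + f u * 'D_v g u)).
Proof.
move=> /derivableP df /derivableP dg.
have dfg := @is_deriveM _ _ _ _ _ _ _ _ df dg.
apply: (is_derive_eq (@is_deriveZ _ _ _ _ s _ _ _ dfg)).
by rewrite /GRing.scale /= addrC [g u * _]mulrC.
Qed.

Lemma is_derive_formM eta zeta u v K :
  form_derivable u eta -> form_derivable u zeta ->
  is_derive u v (fun y => (eta y * zeta y) K : R)
   ((form_deriv v eta u * zeta u + eta u * form_deriv v zeta u) K).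
Proof.
move=> de dz.
pose F (I : {set 'I_N}) (y : 'rV[R]_N) : R :=
  (-1) ^+ ext_inv I (K :\: I)%SET * (eta y I * zeta y (K :\: I)%SET).
pose F' (I : {set 'I_N}) : R :=
  (-1) ^+ ext_inv I (K :\: I)%SET *
     ('D_v (fun y => eta y I : R) u * zeta u (K :\: I)%SET
      + eta u I * 'D_v (fun y => zeta y (K :\: I)%SET : R) u).
have dF I : is_derive u v (F I) (F' I).
  by apply: is_derive_scaledM; [apply: de | apply: dz].
have -> : (fun y => (eta y * zeta y) K : R)
    = \sum_(I : {set 'I_N} | I \subset K) F I.
  by apply/funext => y; rewrite ext_mulE fct_sumE.
have -> : (form_deriv v eta u * zeta u + eta u * form_deriv v zeta u) K
    = \sum_(I : {set 'I_N} | I \subset K) F' I.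
  transitivity ((form_deriv v eta u * zeta u) K + (eta u * form_deriv v zeta u) K).
    by rewrite [LHS]ffunE.
  rewrite !ext_mulE -big_split; apply: eq_bigr => I _ /=.
  by rewrite !ffunE /F' mulrDr.
elim/big_ind2: _ => [|f f' g g' ? ?|I _] //; first exact: is_derive_cst.
exact: is_deriveD.
Qed.

Lemma form_derivableM eta zeta u :
  form_derivable u eta -> form_derivable u zeta ->
  form_derivable u (fun y => eta y * zeta y).
Proof. by move=> de dz v I; have [] := is_derive_formM v I de dz. Qed.

(** The differential of a coefficient of eta enters as a 1-form on the left of
the product; moving it past eta gives the sign. *)
Lemma form_dM p eta zeta u : (forall y, ext_homog p (eta y)) ->
  form_derivable u eta -> form_derivable u zeta ->
  form_d (fun y => eta y * zeta y) u
  = form_d eta u * zeta u + (-1) ^+ p *: (eta u * form_d zeta u).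
Proof.
move=> he de dz; rewrite !form_dE mulr_suml mulr_sumr scaler_sumr -big_split.
apply: eq_bigr => k _ /=.
have -> : form_pderiv k (fun y => eta y * zeta y) u
   = form_pderiv k eta u * zeta u + eta u * form_pderiv k zeta u.
  apply/ffunP => K; rewrite [LHS]ffunE /pderiv.
  by have [_ ->] := is_derive_formM (delta_mx 0 k) K de dz.
by rewrite mulrDr !mulrA (ext_genC k (he u)) -scalerAl.
Qed.

Lemma form_d_homog p eta u : (forall y, ext_homog p (eta y)) ->
  ext_homog p.+1 (form_d eta u).
Proof.
move=> he; rewrite form_dE; apply: ext_homog_sum => k _; rewrite -add1n.
apply: ext_homogM => [|I nI]; first exact: ext_homog_gen.
rewrite ffunE /pderiv (_ : (fun y => _) = cst 0) ?derive_cst //.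
by apply/funext => y; rewrite he.
Qed.

Lemma smooth_form_cst W (a : ext R N) : smooth_form W (fun=> a).
Proof.
move=> m I; move: (a I : R) => c; elim: m c => [|m IHm] c /=.
  by split=> // x _; apply: cst_continuous.
split; first by move=> x _; apply: cst_continuous.
split=> [k x _|k]; first exact: derivable_cst.
rewrite (_ : pderiv k (fun=> c) = (fun=> 0)); first exact: IHm.
by apply/funext => x; rewrite /pderiv derive_cst.
Qed.

End ExteriorDerivative.

(** * The tautological forms and the homomorphism iota *)

Section FrameBundleForms.
Variables (R : realType) (n : nat).
Local Notation N := (n + n * n)%N.
Implicit Types (u X : 'rV[R]_N).

Lemma differentiable_det (V : normedModType R) m (M : V -> 'M[R]_m) x :
  (forall i j, differentiable (fun y => M y i j : R) x) ->
  differentiable (fun y => \det (M y) : R) x.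
Proof.
move=> dM; rewrite /determinant.
have dprod (s : 'I_m -> 'I_m) (r : seq 'I_m) :
    differentiable (fun y => \prod_(i <- r) M y i (s i) : R) x.
  elim: r => [|i r IHr].
    by under eq_fun do rewrite big_nil; apply: differentiable_cst.
  by under eq_fun do rewrite big_cons; apply: differentiableM.
elim: (index_enum _) => [|s r IHr].
  by under eq_fun do rewrite big_nil; apply: differentiable_cst.
under eq_fun do rewrite big_cons.
by apply: differentiableD => //; apply: differentiableZ; apply: dprod.
Qed.

Lemma differentiable_frame_mx u i j :
  differentiable (fun y : 'rV[R]_N => frame_mx y i j : R) u.
Proof.
rewrite (_ : (fun y => _) = (fun y : 'rV[R]_N => y 0 (rshift n (mxvec_index i j)) : R)).
  exact: differentiable_coord.
by apply/funext => y; rewrite /frame_mx !mxE.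
Qed.

(** Cramer's rule; it agrees with [invmx] only where the determinant is nonzero,
which holds near u. *)
Lemma derivable_invmx u i j v : frame_mx u \in unitmx ->
  derivable (fun y : 'rV[R]_N => invmx (frame_mx y) i j : R) u v.
Proof.
move=> uu; pose d (y : 'rV[R]_N) : R := \det (frame_mx y).
have dd : differentiable d u by apply: differentiable_det => ? ?; apply: differentiable_frame_mx.
have d0 : d u != 0 by rewrite -unitfE -unitmxE.
apply: (@near_eq_derivable _ _ _ ((fun y => (d y)^-1) * (fun y => cofactor (frame_mx y) j i : R))).
  have near0 : nbhs (d u) [set x | x != 0].
    by apply: open_nbhs_nbhs; split=> //; apply: open_neq.
  have nearu : \forall y \near u, d y != 0 by exact: (differentiable_continuous dd near0).
  near=> y; have dy : d y != 0 by near: y.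
  by rewrite /invmx unitmxE unitfE -/(d y) dy !mxE.
apply: derivableM; apply: diff_derivable; first exact: differentiableV.
rewrite /cofactor; apply: differentiableZ; apply: differentiable_det => a b.
rewrite (_ : (fun y => _) = (fun y => frame_mx y (lift j a) (lift i b))).
  exact: differentiable_frame_mx.
by apply/funext => y; rewrite [LHS]mxE [LHS]mxE.
Unshelve. all: by end_near. Qed.

Lemma theta_homog i y : ext_homog 1 (theta i y : ext R N).
Proof. by apply: ext_homog_sum => j _; apply: ext_homogZ; apply: ext_homog_gen. Qed.

Lemma form_derivable_sum (I : finType) (F : I -> dform R N) u :
  (forall i, form_derivable u (F i)) -> form_derivable u (fun y => \sum_i F i y).
Proof.
move=> dF; elim: (index_enum I) => [|i r IHr].
  by under eq_fun do rewrite big_nil; apply: form_derivable_cst.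
under eq_fun do rewrite big_cons -[F _ _]scale1r.
exact: form_derivable_lin.
Qed.

Lemma theta_derivable u i : frame_mx u \in unitmx ->
  form_derivable u (theta i : dform R N).
Proof.
move=> uu; apply: form_derivable_sum => j v I.
rewrite (_ : (fun y => _) = (fun y => invmx (frame_mx y) i j : R) *
    cst (ext_gen (lshift (n * n) j) I : R)).
  by apply: derivableM; [apply: derivable_invmx | apply: derivable_cst].
by apply/funext => y; rewrite !ffunE.
Qed.

Lemma iotaF_gen (i : 'I_n) : iotaF (ext_gen i) = theta i :> dform R N.
Proof. by apply/funext => y; rewrite /iotaF ext_lift_gen. Qed.

Lemma iotaF_lin (c : R) (a b : ext R n) :
  iotaF (c *: a + b) = (fun y => c *: iotaF a y + iotaF b y).
Proof. by apply/funext => y; rewrite /iotaF linearP. Qed.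

Lemma iotaFM (a b : ext R n) : iotaF (a * b) = (fun y => iotaF a y * iotaF b y).
Proof.
by apply/funext => y; apply: ext_lift_deg1M => i; apply: theta_homog.
Qed.

Lemma iotaF_homog p (a : ext R n) y : ext_homog p a -> ext_homog p (iotaF a y).
Proof. by move=> ha; apply: ext_lift_homog => // i; apply: theta_homog. Qed.

Lemma iotaF_derivable (a : ext R n) u : frame_mx u \in unitmx ->
  form_derivable u (iotaF a).
Proof.
move=> uu; apply: form_derivable_sum => J.
under eq_fun do rewrite -[_ *: _]addr0.
apply: form_derivable_lin; last exact: form_derivable_cst.
elim: (enum J) => [|i s IHs].
  by under eq_fun do rewrite big_nil; apply: form_derivable_cst.
under eq_fun do rewrite big_cons.
by apply: form_derivableM => //; apply: theta_derivable.
Qed.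

Lemma form_d_iotaF_lin u (c : R) (a b : ext R n) : frame_mx u \in unitmx ->
  form_d (iotaF (c *: a + b)) u = c *: form_d (iotaF a) u + form_d (iotaF b) u.
Proof. by move=> uu; rewrite iotaF_lin form_d_lin //; apply: iotaF_derivable. Qed.

Lemma form_d_iotaFM p u (a b : ext R n) : frame_mx u \in unitmx ->
  ext_homog p a -> form_d (iotaF (a * b)) u =
   form_d (iotaF a) u * iotaF b u + (-1) ^+ p *: (iotaF a u * form_d (iotaF b) u).
Proof.
move=> uu ha; rewrite iotaFM (@form_dM _ _ p) //; first by move=> y; apply: iotaF_homog.
  exact: iotaF_derivable.
exact: iotaF_derivable.
Qed.

End FrameBundleForms.

(** * Pullback of forms to a plane *)

(** Turns a map proved linear under local hypotheses into an element of 'Hom. *)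
Lemma lfun_of_linear (K : fieldType) (V W : vectType K) (f : V -> W) :
  linear f -> exists h : 'Hom(V, W), forall x, h x = f x.
Proof.
move=> f_lin.
pose f_isLin := GRing.isLinear.Build K V W *:%R f f_lin.
pose F : {linear V -> W} := HB.pack f f_isLin.
by exists (linfun F) => x; rewrite lfunE.
Qed.

Section Pullback.
Variables (R : realType) (N n : nat) (v : 'I_n -> 'rV[R]_N).
Implicit Types (a b : ext R N) (X : 'rV[R]_N).

Lemma eval1_linl (c : R) a b X : eval1 (c *: a + b) X = c * eval1 a X + eval1 b X.
Proof.
rewrite /eval1 mulr_sumr -big_split; apply: eq_bigr => k _ /=.
by rewrite !ffunE mulrDl -mulrA.
Qed.

Lemma eval1_linr (c : R) a X Y : eval1 a (c *: X + Y) = c * eval1 a X + eval1 a Y.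
Proof.
rewrite /eval1 mulr_sumr -big_split; apply: eq_bigr => k _ /=.
by rewrite !mxE mulrDr mulrCA.
Qed.

Lemma eval1_suml (I : finType) (c : I -> R) (F : I -> ext R N) X :
  eval1 (\sum_i c i *: F i) X = \sum_i c i * eval1 (F i) X.
Proof.
elim: (index_enum I) => [|i s IHs]; last by rewrite !big_cons eval1_linl IHs.
by rewrite !big_nil /eval1 big1 // => k _; rewrite ffunE mul0r.
Qed.

Lemma eval1_sumr (I : finType) (c : I -> R) a (F : I -> 'rV[R]_N) :
  eval1 a (\sum_i c i *: F i) = \sum_i c i * eval1 a (F i).
Proof.
elim: (index_enum I) => [|i s IHs]; last by rewrite !big_cons eval1_linr IHs.
by rewrite !big_nil /eval1 big1 // => k _; rewrite mxE mulr0.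
Qed.

Lemma eval1_gen l X : eval1 (ext_gen l) X = X 0 l.
Proof.
rewrite /eval1 (bigD1 l) //= big1 ?addr0 => [|k nkl]; rewrite ffunE.
  by rewrite eqxx mul1r.
by rewrite (inj_eq set1_inj) (negbTE nkl) mul0r.
Qed.

(** The pullback along the linear map R^n -> R^N that sends e_s to v s. *)
Definition pullback a : ext R n := ext_lift (fun j => \sum_s v s 0 j *: ext_gen s) a.

HB.instance Definition _ := GRing.Linear.copy pullback
  (ext_lift (fun j => \sum_s v s 0 j *: ext_gen s)).

Lemma pullback_gen_homog j : ext_homog 1 (\sum_s v s 0 j *: ext_gen s : ext R n).
Proof. by apply: ext_homog_sum => s _; apply: ext_homogZ; apply: ext_homog_gen. Qed.

Lemma pullbackM a b : pullback (a * b) = pullback a * pullback b.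
Proof. by apply: ext_lift_deg1M; apply: pullback_gen_homog. Qed.

Lemma pullback_homog p a : ext_homog p a -> ext_homog p (pullback a).
Proof. by apply: ext_lift_homog; apply: pullback_gen_homog. Qed.

Lemma pullback_deg1 a : ext_homog 1 a ->
  pullback a = \sum_s eval1 a (v s) *: ext_gen s.
Proof.
move=> ha; rewrite {1}(ext_deg1_expand ha) linear_sum /=.
under eq_bigr => l _ do rewrite linearZ /= [pullback _]ext_lift_gen scaler_sumr.
rewrite exchange_big; apply: eq_bigr => s _ /=.
by rewrite scaler_suml; apply: eq_bigr => l _; rewrite scalerA.
Qed.

(** Evaluation on vectors of the span of the v t is a pullback that factors
through the pullback to R^n. *)
Lemma pullback0_vanishes (E : {vspace 'rV[R]_N}) a :
  (forall X, X \in E -> exists c : 'I_n -> R, X = \sum_t c t *: v t) ->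
  pullback a = 0 -> vanishes_on E a.
Proof.
move=> Ev a0 k w wE.
pose C s := projT1 (cid (Ev _ (wE s))).
have wC s : w s = \sum_t C s t *: v t by exact: projT2 (cid (Ev _ (wE s))).
pose phi (t : 'I_n) : ext R k := \sum_s C s t *: ext_gen s.
have phi1 t : ext_homog 1 (phi t).
  by apply: ext_homog_sum => s _; apply: ext_homogZ; apply: ext_homog_gen.
rewrite /ext_eval (_ : ext_lift _ a = ext_lift phi (pullback a)).
  by rewrite a0 linear0 ffunE.
rewrite ext_lift_deg1_comp //; apply: ext_lift_eq => j.
rewrite linear_sum /=.
under [RHS]eq_bigr => t _ do rewrite linearZ /= ext_lift_gen scaler_sumr.
rewrite exchange_big; apply: eq_bigr => s _ /=.
rewrite wC summxE scaler_suml; apply: eq_bigr => t _.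
by rewrite scalerA mxE mulrC.
Qed.

End Pullback.

(** * Transverse planes and the derivations they define *)

Section ConnectionPlane.
Variables (R : realType) (n : nat).
Local Notation N := (n + n * n)%N.
Variables (U : set 'rV[R]_n) (omega : 'I_n -> 'I_n -> dform R N) (u : 'rV[R]_N).
Hypothesis omega_conn : connection_form U omega.
Hypothesis omega_tf : torsion_free U omega.
Hypothesis Fu : frame_bundle U u.
Implicit Types (P : {ffun 'I_n -> 'M[R]_n}) (X Y : 'rV[R]_N).

Let frame_unit : frame_mx u \in unitmx. Proof. by case: Fu. Qed.

Lemma eval1_theta i X :
  eval1 (theta i u) X = (invmx (frame_mx u) *m (base_pt X)^T) i 0.
Proof.
rewrite eval1_suml mxE; apply: eq_bigr => j _.
by rewrite eval1_gen !mxE.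
Qed.

Lemma mx_eval1_lin (c : R) X Y :
  mx_eval1 omega u (c *: X + Y) = c *: mx_eval1 omega u X + mx_eval1 omega u Y.
Proof. by apply/matrixP => i j; rewrite !mxE eval1_linr. Qed.

(** A lift to the frame bundle of the k-th vector of the frame u; [frame_vec]
corrects it by a vertical vector to give omega the value P k. *)
Definition frame_lift k : 'rV[R]_N := mkF (row k (frame_mx u)^T) 0.

Definition frame_vec P k : 'rV[R]_N := frame_lift k +
  mkF 0 (frame_mx u *m (P k - mx_eval1 omega u (frame_lift k))).

Lemma eval1_theta_frame P i k : eval1 (theta i u) (frame_vec P k) = (i == k)%:R.
Proof.
rewrite eval1_theta /base_pt /frame_vec linearD /= /mkF !row_mxKl addr0.
by rewrite -tr_col trmxK colE mulmxA mulVmx // mul1mx mxE eqxx andbT.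
Qed.

Lemma mx_eval1_frame P k : mx_eval1 omega u (frame_vec P k) = P k.
Proof.
have [_ _ vert _] := omega_conn.
rewrite /frame_vec -[frame_lift k]scale1r mx_eval1_lin vert //.
by rewrite !scale1r addrC subrK.
Qed.

(** The forms theta_i and omega_ij together are a coframe: where the theta_i
vanish, X is a fundamental vertical field, recovered from omega. *)
Lemma coframe_eq0 X : (forall i, eval1 (theta i u) X = 0) ->
  mx_eval1 omega u X = 0 -> X = 0.
Proof.
move=> th0 om0; have [_ _ vert _] := omega_conn.
have base0 : base_pt X = 0.
  apply: trmx_inj; rewrite -[LHS](mulKVmx frame_unit).
  rewrite [X in _ *m X](_ : _ = 0) ?mulmx0 ?trmx0 //.
  by apply/matrixP => i j; rewrite ord1 -eval1_theta th0 mxE.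
have XE : X = mkF 0 (frame_mx u *m (invmx (frame_mx u) *m frame_mx X)).
  by rewrite mulKVmx // -base0 /mkF /frame_mx vec_mxK hsubmxK.
move: om0; rewrite XE vert // => ->.
by rewrite mulmx0 /mkF linear0 row_mx0.
Qed.

Definition conn_of (p : 'M['rV[R]_n]_n) : {ffun 'I_n -> 'M[R]_n} :=
  [ffun k => \matrix_(i, j) p i j 0 k].

Lemma plane_of_expand p E X : plane_of omega u p E -> X \in E ->
  X = \sum_k eval1 (theta k u) X *: frame_vec (conn_of p) k.
Proof.
move=> [_ pE] XE; apply/eqP; rewrite -subr_eq0; apply/eqP.
set Y := \sum_k _.
rewrite addrC -scaleN1r; apply: coframe_eq0 => [i|].
  rewrite eval1_linr eval1_sumr (bigD1 i) //= big1 => [|k nki].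
    by rewrite addr0 eval1_theta_frame eqxx mulr1 mulN1r addNr.
  by rewrite eval1_theta_frame eq_sym (negbTE nki) mulr0.
apply/matrixP => i j; rewrite mx_eval1_lin !mxE (pE i j X XE) eval1_sumr.
rewrite mulN1r addrC; apply/eqP; rewrite subr_eq0; apply/eqP.
apply: eq_bigr => k _; have := mx_eval1_frame (conn_of p) k.
move=> /matrixP/(_ i j); rewrite ffunE !mxE => ->.
by rewrite mulrC.
Qed.

Lemma frame_free P : free [tuple frame_vec P k | k < n].
Proof.
apply/freeP => c; under eq_bigr do rewrite -tnth_nth tnth_mktuple.
move=> c0 i; have : eval1 (theta i u) (\sum_k c k *: frame_vec P k) = 0.
  by rewrite c0 /eval1 big1 // => l _; rewrite mxE mulr0.
rewrite eval1_sumr (bigD1 i) //= big1 => [|k nki].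
  by rewrite addr0 eval1_theta_frame eqxx mulr1.
by rewrite eval1_theta_frame eq_sym (negbTE nki) mulr0.
Qed.

Lemma mem_frame_span P X : X \in <<[tuple frame_vec P k | k < n]>>%VS ->
  exists c : 'I_n -> R, X = \sum_k c k *: frame_vec P k.
Proof.
move=> /coord_span XE; exists (fun k => coord [tuple frame_vec P k | k < n] k X).
by rewrite {1}XE; apply: eq_bigr => k _; rewrite -tnth_nth tnth_mktuple.
Qed.

(** E is contained in the span of the n vectors [frame_vec], and has
dimension n. *)
Lemma frame_vec_mem p E k : plane_of omega u p E -> frame_vec (conn_of p) k \in E.
Proof.
move=> Ep; suff -> : E = <<[tuple frame_vec (conn_of p) k | k < n]>>%VS.
  by apply: memv_span; apply/tnthP; exists k; rewrite tnth_mktuple.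
apply/eqP; rewrite eqEdim; apply/andP; split.
  apply/subvP => X XE; rewrite (plane_of_expand Ep XE).
  apply: memv_suml => i _; apply: memvZ; apply: memv_span.
  by apply/tnthP; exists i; rewrite tnth_mktuple.
by case: Ep => [[-> _] _]; apply: leq_trans (dim_span _) _; rewrite size_tuple.
Qed.

Lemma plane_of_frame p :
  plane_of omega u p <<[tuple frame_vec (conn_of p) k | k < n]>>%VS.
Proof.
have thE c i :
    eval1 (theta i u) (\sum_k c k *: frame_vec (conn_of p) k) = c i.
  rewrite eval1_sumr (bigD1 i) //= big1 => [|k nki].
    by rewrite addr0 eval1_theta_frame eqxx mulr1.
  by rewrite eval1_theta_frame eq_sym (negbTE nki) mulr0.
split.
  split; first by have /eqP := frame_free (conn_of p); rewrite size_tuple.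
  move=> X /mem_frame_span[c XE] X0; rewrite XE big1 // => k _.
  rewrite -[c k]thE -XE eval1_theta X0 trmx0 mulmx0 mxE scale0r //.
move=> i j X /mem_frame_span[c ->]; rewrite eval1_sumr.
apply: eq_bigr => k _; rewrite thE; have := mx_eval1_frame (conn_of p) k.
by move=> /matrixP/(_ i j); rewrite ffunE !mxE => ->; rewrite mulrC.
Qed.

Lemma pullback_iotaF P (a : ext R n) : pullback (frame_vec P) (iotaF a u) = a.
Proof.
rewrite /pullback /iotaF ext_lift_deg1_comp; last exact: pullback_gen_homog.
rewrite -[RHS]ext_lift_ext_gen; apply: ext_lift_eq => i.
rewrite [LHS]pullback_deg1; last exact: theta_homog.
rewrite (bigD1 i) //= big1 => [|k nki].
  by rewrite addr0 eval1_theta_frame eqxx scale1r.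
by rewrite eval1_theta_frame eq_sym (negbTE nki) scale0r.
Qed.

(** The derivation with coefficients P, obtained as the exterior derivative on
the plane with coordinates P; its Leibniz rule is that of d. *)
Lemma conn_deriv_of_plane P : exists2 h : 'End(ext R n), conn_deriv P h &
  forall a, h a = pullback (frame_vec P) (form_d (iotaF a) u).
Proof.
have lin : linear (fun a : ext R n => pullback (frame_vec P) (form_d (iotaF a) u)).
  by move=> c a b; rewrite form_d_iotaF_lin // linearP.
have [h hE] := lfun_of_linear lin.
exists h => //; split; first split.
- move=> p a ha; rewrite hE; apply: pullback_homog; apply: form_d_homog.
  by move=> y; apply: iotaF_homog.
- move=> p a b ha; rewrite !hE (form_d_iotaFM _ _ ha) // linearD linearZ /=.
  by rewrite !pullbackM !pullback_iotaF.
move=> i; rewrite hE iotaF_gen omega_tf // [LHS]linearN [X in - X = _]linear_sum; congr (- _).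
apply: eq_bigr => j _ /=; rewrite pullbackM -iotaF_gen pullback_iotaF.
have [_ hom _ _] := omega_conn.
rewrite (pullback_deg1 _ (hom i j u Fu)) mulr_suml; apply: eq_bigr => k _.
by rewrite -scalerAl -[P k](mx_eval1_frame P k) mxE.
Qed.

(** The generator d (iota a) - iota (f a) restricts to D_p a - f a on the plane
of p, and d (iota (f a)) to D_p (f a), which is f (f a) once D_p = f on A.
This is applied to f and to the zero operator alike. *)
Lemma Z_AfP (A : {vspace ext R n}) (f : 'End(subvs_of A)) p :
  (forall a, f (f a) = 0) ->
  Z_Af f U omega u p <->
  exists2 h : 'End(ext R n), conn_deriv (conn_of p) h & extends_op f h.
Proof.
move=> ff0; have [h hP hE] := conn_deriv_of_plane (conn_of p).
split=> [[E [Ep Ivan]]|[h' h'P h'f]].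
  exists h => // a; apply/eqP; rewrite -subr_eq0; apply/eqP.
  apply: ext_top_nondeg => b.
  (* Multiplying by constant forms keeps within the ideal and reaches every b. *)
  pose eta y := form_d (iotaF (vsval a)) y - iotaF (vsval (f a)) y.
  have Ieta : I_Af f U (fun y => eta y * iotaF b u).
    apply: Ideal_mulr; first exact: smooth_form_cst.
    by apply: Ideal_gen; exists a; left.
  have := Ivan _ Ieta n (frame_vec (conn_of p)) (fun k => frame_vec_mem k Ep).
  rewrite /ext_eval -/(pullback _ _) pullbackM pullback_iotaF linearB /=.
  by rewrite pullback_iotaF -hE.
rewrite (conn_deriv_uniq h'P hP) in h'f.
exists <<[tuple frame_vec (conn_of p) k | k < n]>>%VS.
split=> [|eta Ieta]; first exact: plane_of_frame.
apply: pullback0_vanishes (@mem_frame_span (conn_of p)) _.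
elim: Ieta => {eta} [eta [a [->|->]]||eta zeta _ IHe _ IHz|phi eta _ _ IHe|phi eta _ _ IHe].
- by rewrite linearB /= pullback_iotaF -hE h'f subrr.
- by rewrite -hE h'f ff0.
- exact: linear0.
- by rewrite linearD /= IHe IHz addr0.
- by rewrite pullbackM IHe mulr0.
- by rewrite pullbackM IHe mul0r.
Qed.

End ConnectionPlane.

(** * Equivariant extensions *)

Section EquivariantExtension.
Variables (R : realType) (n : nat).
Implicit Types (P Q : {ffun 'I_n -> 'M[R]_n}) (h : 'End(ext R n)).
Variables (G : set 'M[R]_n) (A : {vspace ext R n}) (f : 'End(subvs_of A)).
Variable D : {ffun 'I_n -> 'M[R]_n} -> 'End(ext R n).
Hypothesis D_deriv : forall P, conn_deriv P (D P).
Hypothesis G_orth : forall g, G g -> g *m g^T = 1%:M.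
Hypothesis G_inv : sub_invariants G A.

(** The solutions P of D P = f on A form a coset of the kernel W of the
restriction map P |-> D P on A; its shortest element is fixed by G. *)
Lemma equivariant_extension P0 : extends_op f (D P0) ->
  exists2 P, extends_op f (D P) & equivariant G (D P).
Proof.
move=> P0f.
have D_lin (k : R) P Q : D (k *: P + Q) = k *: D P + D Q.
  by apply: conn_deriv_uniq (D_deriv _) _; apply: conn_deriv_lin.
have resA_lin : linear (fun P => (D P \o linfun (@vsval _ _ A))%VF).
  by move=> k P Q; rewrite D_lin comp_lfunDl comp_lfunZl.
have [resA resAE] := lfun_of_linear resA_lin.
pose W := lker resA.
have WP P : reflect (forall a : subvs_of A, D P (vsval a) = 0) (P \in W).
  rewrite memv_ker resAE; apply: (iffP eqP) => [/lfunP Pa a|Pa].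
    by have := Pa a; rewrite comp_lfunE lfunE zero_lfunE.
  by apply/lfunP => a; rewrite comp_lfunE lfunE zero_lfunE; apply: Pa.
have WB P Q : extends_op f (D Q) -> (P - Q \in W <-> extends_op f (D P)).
  move=> Qf; have DB : D (P - Q) = D P - D Q.
    by rewrite addrC -scaleN1r D_lin scaleN1r addrC.
  split=> [/WP PQ a|Pf].
    apply/eqP; rewrite -Qf -subr_eq0 -(PQ a) DB.
    by rewrite add_lfunE opp_lfunE.
  by apply/WP => a; rewrite DB add_lfunE opp_lfunE Pf Qf subrr.
have dotC P Q : conn_dot P Q = conn_dot Q P.
  by do 3!apply: eq_bigr => ? _; rewrite mulrC.
have dotD P P' Q : conn_dot (P + P') Q = conn_dot P Q + conn_dot P' Q.
  do 3!(rewrite -big_split; apply: eq_bigr => ? _ /=).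
  by rewrite ffunE mxE mulrDl.
have dotZ k P Q : conn_dot (k *: P) Q = k * conn_dot P Q.
  do 3!(rewrite mulr_sumr; apply: eq_bigr => ? _ /=).
  by rewrite ffunE mxE mulrA.
have [P PW Pmin] := unique_shortest dotC dotD dotZ (@conn_dot_gt0 R n) W P0.
have Pf : extends_op f (D P) by apply/(WB _ _ P0f).
exists P => // g a Gg; have gg := G_orth Gg.
have gP := conn_deriv_act gg (D_deriv P) (D_deriv (conn_act g P)).
suff gPP : conn_act g P = P by rewrite -gP gPP.
apply: (Pmin _ _ (conn_act_isometry P gg)).
(* g P is again a solution, because g fixes both b and f b. *)
apply/(WB _ _ P0f) => b.
by rewrite -{1}(G_inv Gg (subvsP b)) gP Pf (G_inv Gg) ?subvsP.
Qed.

End EquivariantExtension.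

Theorem lemma4 (R : realType) (n : nat) (G : set 'M[R]_n)
    (A : {vspace ext R n}) (f : 'End(subvs_of A))
    (U : set 'rV[R]_n) (omega : 'I_n -> 'I_n -> dform R (n + n * n))
    (u : 'rV[R]_(n + n * n)) :
  compact_subgroup_O G ->
  graded_subalgebra A -> sub_invariants G A ->
  differential_operator f ->
  open U -> connection_form U omega -> torsion_free U omega ->
  frame_bundle U u ->
  (Z_Af f U omega u !=set0 <->
     exists h : 'End(ext R n), derivation1 h /\ extends_op f h) /\
  (Z_Af f U omega u !=set0 ->
     (exists p0, Z_Af f U omega u =
        [set p0 + p | p in Z_Af (0 : 'End(subvs_of A)) U omega u]) /\
     (exists h : 'End(ext R n),
        [/\ derivation1 h, extends_op f h & equivariant G h])).
Proof.
move=> [_ G_orth _ _ _] _ G_inv [_ _ ff0] _ omega_conn omega_tf Fu.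
have Zf p := Z_AfP omega_conn omega_tf Fu p ff0.
have Z0 p := Z_AfP omega_conn omega_tf Fu (f := 0 : 'End(subvs_of A)) p
  (fun a => zero_lfunE _ _).
pose D P := s2val (cid2 (conn_deriv_of_plane omega_conn omega_tf Fu P)).
have D_deriv P : conn_deriv P (D P).
  exact: s2valP (cid2 (conn_deriv_of_plane omega_conn omega_tf Fu P)).
have conn_ofB p q : conn_of (p + q) = conn_of p + conn_of q.
  by apply/ffunP => k; rewrite !ffunE; apply/matrixP => i j; rewrite !mxE.
split.
  split=> [[p /Zf[h [dh _] hf]]|[h [dh hf]]]; first by exists h.
  have [P hP] := conn_deriv_exists dh.
  exists (\matrix_(i, j) \row_k P k i j); apply/Zf; exists h => //.
  rewrite (_ : conn_of _ = P) //.
  by apply/ffunP => k; rewrite ffunE; apply/matrixP => i j; rewrite !mxE.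
move=> [p0 Zp0]; have [h0 h0P h0f] := (Zf p0).1 Zp0; split.
  exists p0; apply/seteqP; split=> [p /Zf[h hP hf]|_ [p /Z0[h hP hf] <-]].
    exists (p - p0); last by rewrite addrC subrK.
    apply/Z0; exists (-1 *: h0 + h) => [|a].
      rewrite (_ : conn_of (p - p0) = -1 *: conn_of p0 + conn_of p).
        exact: conn_deriv_lin.
      by rewrite -[in RHS](subrK p0 p) [in RHS]conn_ofB scaleN1r addrCA addNr addr0.
    by rewrite add_lfunE scale_lfunE h0f hf zero_lfunE scaleN1r addNr linear0.
  apply/Zf; exists (1 *: h0 + h) => [|a].
    by rewrite conn_ofB -[conn_of p0]scale1r; apply: conn_deriv_lin.
  by rewrite add_lfunE scale_lfunE h0f hf zero_lfunE scale1r linear0 addr0.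
have P0f : extends_op f (D (conn_of p0)).
  by rewrite (conn_deriv_uniq (D_deriv _) h0P).
have [P Pf Peq] := equivariant_extension D_deriv G_orth G_inv P0f.
by exists (D P); split=> //; have [] := D_deriv P.
Qed.
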